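(* The only $3$-dimensional linear subspaces of $\mathbb C^6$ contained in $L_{2,4}$ are the $60$ three-dimensional linear subspaces whose union is the singular locus of $L_{2,4}$. Moreover, $L_{2,4}$ contains no linear subspace of dimension $\ge 4$.
   Context: Coordinates of $\mathbb C^6$ are $l_{ij}$ indexed by the edges $\{i,j\}$ of $K_4$. $L_{2,4}$ is the set of $l\in\mathbb C^6$ such that $(l_{ij}^2)$ equals $(\sum_{k=1}^2({\bf p}_i^k-{\bf p}_j^k)^2)$ for some complex configuration ${\bf p}_1,\dots,{\bf p}_4\in\mathbb C^2$; it is the hypersurface cut out by the determinant of the symmetric $3\times3$ matrix with diagonal $2l_{14}^2,2l_{24}^2,2l_{34}^2$ and off-diagonal entries $l_{14}^2+l_{24}^2-l_{12}^2$, $l_{14}^2+l_{34}^2-l_{13}^2$, $l_{24}^2+l_{34}^2-l_{23}^2$. Its singular locus is a union of 60 three-dimensional linear subspaces: the 32 subspaces $\{l_{12}-s_{13}l_{13}+s_{23}l_{23}=0,\ l_{12}-s_{14}l_{14}+s_{24}l_{24}=0,\ s_{13}l_{13}-s_{14}l_{14}+s_{34}l_{34}=0\}$ with $s_{ij}\in\{\pm1\}$; the 24 subspaces $\{l_{ab}=0,\ l_{ac}=\pm l_{bc},\ l_{ae}=\pm l_{be}\}$ for an edge $\{a,b\}$ and $\{c,e\}$ the remaining vertices; and the 4 subspaces $\{l_{ab}=l_{ac}=l_{bc}=0\}$ for triangles $\{a,b,c\}$. *)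

(* Defs.v *)
From HB Require Import structures.
From mathcomp Require Import all_boot all_order all_algebra.
From mathcomp Require Import complex.
From mathcomp Require Import reals.
Set Implicit Arguments. Unset Strict Implicit. Unset Printing Implicit Defensive.
Import Order.TTheory GRing.Theory Num.Theory.
Local Open Scope ring_scope.

(* Coordinates of C^6 = 'rV[C]_6, indexed by the edges of K_4 with vertices
   0,1,2,3 (paper's 1,2,3,4), in the order
   {1,2},{1,3},{1,4},{2,3},{2,4},{3,4} |-> columns 0..5. *)
Definition edge_idx (i j : nat) : nat :=
  match minn i j, maxn i j with
  | 0, 1 => 0 | 0, 2 => 1 | 0, 3 => 2
  | 1, 2 => 3 | 1, 3 => 4 | _, _ => 5
  end%N.

Section K4.
Variable C : fieldType.

(* l_{ij} for distinct vertices i j : 'I_4 (symmetric in i, j) *)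
Definition lc (l : 'rV[C]_6) (i j : 'I_4) : C := l ord0 (inord (edge_idx i j)).

Definition L24_matrix (l : 'rV[C]_6) : 'M[C]_3 :=
  \matrix_(i < 3, j < 3)
    let a : 'I_4 := widen_ord (leqnSn 3) i in
    let b : 'I_4 := widen_ord (leqnSn 3) j in
    if i == j then 2 * (lc l a ord_max) ^+ 2
    else (lc l a ord_max) ^+ 2 + (lc l b ord_max) ^+ 2 - (lc l a b) ^+ 2.

Definition in_L24 (l : 'rV[C]_6) : bool := \det (L24_matrix l) == 0.

Definition sgn (b : bool) : C := if b then 1 else -1.

Definition v1 : 'I_4 := inord 0.
Definition v2 : 'I_4 := inord 1.
Definition v3 : 'I_4 := inord 2.
Definition v4 : 'I_4 := inord 3.

Definition singA (s13 s14 s23 s24 s34 : bool) (l : 'rV[C]_6) : bool :=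
  [&& lc l v1 v2 - sgn s13 * lc l v1 v3 + sgn s23 * lc l v2 v3 == 0,
      lc l v1 v2 - sgn s14 * lc l v1 v4 + sgn s24 * lc l v2 v4 == 0 &
      sgn s13 * lc l v1 v3 - sgn s14 * lc l v1 v4 + sgn s34 * lc l v3 v4 == 0].

Definition singB (a b c e : 'I_4) (t1 t2 : bool) (l : 'rV[C]_6) : bool :=
  [&& lc l a b == 0, lc l a c == sgn t1 * lc l b c & lc l a e == sgn t2 * lc l b e].

Definition singC (a b c : 'I_4) (l : 'rV[C]_6) : bool :=
  [&& lc l a b == 0, lc l a c == 0 & lc l b c == 0].

(* U is one of the 60 three-dimensional subspaces making up Sing(L_{2,4}) *)
Definition is_sing_component (U : {vspace 'rV[C]_6}) : Prop :=
  (exists s13 s14 s23 s24 s34 : bool,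
      forall l, (l \in U) = singA s13 s14 s23 s24 s34 l)
  \/ (exists a b c e : 'I_4, uniq [:: a; b; c; e] /\
      exists t1 t2 : bool, forall l, (l \in U) = singB a b c e t1 t2 l)
  \/ (exists a b c : 'I_4, uniq [:: a; b; c] /\
      forall l, (l \in U) = singC a b c l).

End K4.

(* Main.v *)
Require Import Defs.
From HB Require Import structures.
From mathcomp Require Import all_boot all_order all_algebra.
From mathcomp Require Import complex.
From mathcomp Require Import reals.
From mathcomp Require Import ring zify.
Import Order.TTheory GRing.Theory Num.Theory.
Local Open Scope ring_scope.
Set Implicit Arguments.
Unset Strict Implicit.
Unset Printing Implicit Defensive.

(** Restrict the six coordinates to a three-dimensional U: they become six
linear forms spanning the dual of U, and F, the determinant, vanishes on U.
Three independent edges of K_4 form a triangle, a star or a path.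

Triangle [a = l14], [b = l24], [x = l12] independent.  Write [H_T] for Heron's
product of four linear forms attached to a face T.  Then
[2 a^2 F = H_124 H_134 - M^2], so a linear factor of [H_124] also divides
[H_134].  Hence either a face at 3 is flat, and Stewart's relation forces an
edge to be contracted, or the other faces have the edges of the first one up to
sign; opposite edges are then equal, and such a tetrahedron has nonzero volume.

Star independent, no triangle independent: each edge of the base is a
combination of two edges of the star, and setting one edge of the star to zero
shows that the coefficients are all zero (contracted face) or all signs
(collinear points).

Path 1-2-3-4 independent, no triangle or star independent: l13 and l24 are
multiples of l23, and on [l23 = 0] the determinant is
[2 l12^2 l34^2 (l14^2 - l12^2 - l34^2)], which is not zero.

A subspace of dimension at least 4 would meet the hyperplane where the six
coordinates sum to zero in a space of dimension at least 3, hence that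
hyperplane would contain one of the 60 components, and it contains none. *)

(* Arguments in the edge order 12, 13, 14, 23, 24, 34. *)
Definition cayley (R : comNzRingType) (x y a z b c : R) : R :=
  let p := a ^+ 2 + b ^+ 2 - x ^+ 2 in
  let q := a ^+ 2 + c ^+ 2 - y ^+ 2 in
  let r := b ^+ 2 + c ^+ 2 - z ^+ 2 in
  8 * (a * b * c) ^+ 2 + 2 * (p * q * r)
  - 2 * (a * r) ^+ 2 - 2 * (b * q) ^+ 2 - 2 * (c * p) ^+ 2.

(** In characteristic zero the naturals below [size p] are distinct, which gives more roots than the
    degree allows. *)
Lemma poly_eq0_pointwise (K : numFieldType) (p : {poly K}) :
  (forall t, p.[t] = 0) -> p = 0.
Proof.
move=> p0; apply: (@roots_geq_poly_eq0 K p [seq n%:R | n <- iota 0 (size p)]).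
- by apply/allP => x _; apply/rootP.
- by rewrite map_inj_uniq ?iota_uniq // => m n /eqP; rewrite eqr_nat => /eqP.
- by rewrite size_map size_iota.
Qed.

(** * Linear forms with an independent triangle *)

Section Triangle.
Variable K : numFieldType.

Lemma horner_natr n (s : K) : (n%:R : {poly K}).[s] = n%:R.
Proof. by rewrite -polyC_natr hornerC. Qed.

Definition horner_ringE :=
  (hornerD, hornerN, hornerM, horner_exp, hornerC, hornerX, horner_natr).

Lemma sgn_sqr (s : bool) : sgn K s * sgn K s = 1.
Proof. by case: s; rewrite /sgn ?mulrNN mulr1. Qed.

(* The edges 14, 24, 12 are the coordinates a, b, x; the edges 13, 23, 34 are the
   linear forms with coefficients y, z, c. *)
Definition all_vanish (y1 y2 y3 z1 z2 z3 c1 c2 c3 : K) : Prop :=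
  forall a b x, cayley x (y1 * a + y2 * b + y3 * x) a
                  (z1 * a + z2 * b + z3 * x) b (c1 * a + c2 * b + c3 * x) = 0.

(* As 2 a^2 F = H_124 H_134 - M^2, the simple factor x - a - b of H_124 divides M, and
   then H_134; the conclusion is this at a = 1, b = t, x = 1 + t. *)
Lemma heron_on_plane (y1 y2 y3 z1 z2 z3 c1 c2 c3 : K) :
  all_vanish y1 y2 y3 z1 z2 z3 c1 c2 c3 ->
  forall t, let c := c1 + c3 + (c2 + c3) * t in
            let y := y1 + y3 + (y2 + y3) * t in
  t * (1 + t) * ((1 + c + y) * (1 + c - y) * (1 - c + y) * (1 - c - y)) = 0.
Proof.
move=> H t c y.
(* The indeterminate measures the distance [x - a - b] to the plane, at [a = 1] and [b = t]. *)
pose X : {poly K} := (1 + t)%:P + 'X.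
pose Y := (y1 + y2 * t)%:P + y3%:P * X.
pose Z := (z1 + z2 * t)%:P + z3%:P * X.
pose W := (c1 + c2 * t)%:P + c3%:P * X.
have F0 : cayley X Y 1 Z t%:P W = 0.
  apply: poly_eq0_pointwise => s.
  rewrite -[RHS](H 1 t (1 + t + s)) /cayley /X /Y /Z /W !horner_ringE.
  by ring.
(* [Q] is the Heron product of the face 134, and [J] gathers the factors of that of 124 other than
   ['X]. *)
pose M := 2 * (t%:P ^+ 2 + W ^+ 2 - Z ^+ 2) - (1 + t%:P ^+ 2 - X ^+ 2) * (1 + W ^+ 2 - Y ^+ 2).
pose Q := (1 + W + Y) * (1 + W - Y) * (1 - W + Y) * (1 - W - Y).
pose J := (1 + t%:P + X) * (1 - t%:P + X) * (X - 1 + t%:P).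
have eqM : M ^+ 2 = 'X * (J * Q).
  apply/eqP; rewrite -subr_eq0; apply/eqP.
  transitivity (- 2 * cayley X Y 1 Z t%:P W); last by rewrite F0 mulr0.
  have -> : 'X = X - 1 - t%:P by rewrite /X polyCD; ring.
  by rewrite /M /J /Q /cayley; ring.
(* Now ['X] divides [M], so ['X ^+ 2] divides [M ^+ 2], and one ['X] is left to divide [J * Q]. *)
have /factor_theorem [N eqN] : root M 0.
  apply/rootP/eqP; rewrite -sqrf_eq0 -horner_exp eqM hornerM hornerX mul0r //.
have : (J * Q).[0] = 0.
  suff -> : J * Q = N ^+ 2 * 'X by rewrite hornerM hornerX mulr0.
  apply: (mulfI (negbT (polyX_eq0 K))); rewrite -eqM eqN subr0; ring.
rewrite /J /Q /W /Y /X !horner_ringE /c /y => E.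
(* On the plane the three factors of [J] are [2 * (1 + t)], [2] and [2 * t]. *)
have n8 : (8 : K) != 0 by rewrite pnatr_eq0.
apply: (mulfI n8); rewrite mulr0 -[RHS]E; ring.
Qed.

Lemma affine_poly_eq0 (u v : K) : u%:P + v%:P * 'X = 0 -> u = 0 /\ v = 0.
Proof.
move=> uv0.
have u0 : u = 0 by rewrite -(horner0 0) -uv0 !horner_ringE mulr0 addr0.
by split=> //; rewrite -(horner0 1) -uv0 !horner_ringE u0 add0r mulr1.
Qed.

(** The product of [heron_on_plane] is zero as a polynomial in [t], so one affine factor is zero.
    Some form [a ± c ± y] therefore vanishes on the whole plane [x = a + b]. *)
Lemma flat_on_plane (y1 y2 y3 z1 z2 z3 c1 c2 c3 : K) :
  all_vanish y1 y2 y3 z1 z2 z3 c1 c2 c3 ->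
  exists d1 d2 : bool,
    1 + sgn K d1 * (c1 + c3) + sgn K d2 * (y1 + y3) = 0 /\
    sgn K d1 * (c2 + c3) + sgn K d2 * (y2 + y3) = 0.
Proof.
move=> /heron_on_plane H.
pose L d1 d2 : {poly K} :=
  (1 + sgn K d1 * (c1 + c3) + sgn K d2 * (y1 + y3))%:P
  + (sgn K d1 * (c2 + c3) + sgn K d2 * (y2 + y3))%:P * 'X.
have L0 : 'X * (1%:P + 1%:P * 'X) *
    (L true true * L true false * L false true * L false false) = 0.
  apply: poly_eq0_pointwise => t; rewrite -[RHS](H t) /L /sgn !horner_ringE.
  by ring.
have fin d1 d2 : L d1 d2 == 0 -> exists d1 d2 : bool,
    1 + sgn K d1 * (c1 + c3) + sgn K d2 * (y1 + y3) = 0 /\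
    sgn K d1 * (c2 + c3) + sgn K d2 * (y2 + y3) = 0.
  by move=> /eqP/affine_poly_eq0; exists d1, d2.
move/eqP: L0; rewrite !mulf_eq0 polyX_eq0 -!orbA /=.
case/or4P; last case/orP; try exact: fin.
by move=> /eqP/affine_poly_eq0[/eqP]; rewrite oner_eq0.
Qed.

(** Only squares of edges enter [cayley]. The sign changes carry the plane [x = a + b] to the four
    planes [x = ± a ± b]. *)
Lemma all_vanish_sgn (e f : bool) (y1 y2 y3 z1 z2 z3 c1 c2 c3 : K) :
  all_vanish y1 y2 y3 z1 z2 z3 c1 c2 c3 ->
  all_vanish (y1 * sgn K e) (y2 * sgn K f) y3 (z1 * sgn K e) (z2 * sgn K f) z3
             (c1 * sgn K e) (c2 * sgn K f) c3.
Proof.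
move=> H a b x; rewrite -[RHS](H (sgn K e * a) (sgn K f * b) x) /cayley /sgn.
by case: e; case: f; ring.
Qed.

(** This is the exchange of the vertices 1 and 2; it turns results on the face 134 into results on
    234. *)
Lemma all_vanish_swap (y1 y2 y3 z1 z2 z3 c1 c2 c3 : K) :
  all_vanish y1 y2 y3 z1 z2 z3 c1 c2 c3 ->
  all_vanish z2 z1 z3 y2 y1 y3 c2 c1 c3.
Proof. by move=> H a b x; rewrite -[RHS](H b a x) /cayley; ring. Qed.

(** Here [e] picks the plane [x = ± a ± b], and [d] picks the form [a ± c ± y] that vanishes on it;
    the two equations are its coefficients in [a] and [b] after elimination of [x]. *)
Lemma flat_on_planes (y1 y2 y3 z1 z2 z3 c1 c2 c3 : K) :
  all_vanish y1 y2 y3 z1 z2 z3 c1 c2 c3 ->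
  forall e : bool * bool, exists d : bool * bool,
    1 + sgn K d.1 * c1 + sgn K d.2 * y1
      + sgn K e.1 * (sgn K d.1 * c3 + sgn K d.2 * y3) = 0 /\
    sgn K d.1 * c2 + sgn K d.2 * y2
      + sgn K e.2 * (sgn K d.1 * c3 + sgn K d.2 * y3) = 0.
Proof.
move=> H [e f]; have [d1 [d2 [E1 E2]]] := flat_on_plane (all_vanish_sgn e f H).
(* The test [e == d1] is the product of signs; multiplying by the sign [e] restores the coefficient
   1 of [a]. *)
exists (e == d1, e == d2); rewrite /=.
by split; [rewrite -[RHS]E1 | rewrite -[RHS](mulr0 (sgn K e * sgn K f)) -E2];
   move: e f d1 d2 {E1 E2} => [] [] [] []; rewrite /sgn /=; ring.
Qed.

Lemma eq_half (u v : K) : u + u = v + v -> u = v.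
Proof. by rewrite -!mulr2n => /eqP; rewrite eqrMn2r => /eqP. Qed.

(** Let [g] have coefficients [u], [v], [w]. If [a + g] and [a - g] each vanish on one of the four
    planes, adding the equations eliminates [u] and [v] and forces [w] to be a sign; this determines
    [g]. *)
Lemma opposite_planes (e f e' f' : bool) (u v w : K) :
  1 + u + sgn K e * w = 0 -> v + sgn K f * w = 0 ->
  1 - u - sgn K e' * w = 0 -> - v - sgn K f' * w = 0 ->
  [/\ e' = ~~ e, f' = f, u = 0, v = sgn K f * sgn K e & w = - sgn K e].
Proof.
have two0 : (2 : K) != 0 by rewrite pnatr_eq0.
move=> E1 E2 E3 E4.
have E13 : 2 + (sgn K e - sgn K e') * w = 0.
  by transitivity ((1 + u + sgn K e * w) + (1 - u - sgn K e' * w));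
    [ring | rewrite E1 E3 addr0].
have ee' : e' = ~~ e.
  by case: e e' E13 {E1 E3} => [] [] // /eqP; rewrite subrr mul0r addr0 (negbTE two0).
have we : w = - sgn K e.
  apply: (mulfI two0); apply/eqP; rewrite -subr_eq0; apply/eqP.
  transitivity (sgn K e * (2 + (sgn K e - sgn K e') * w)); last by rewrite E13 mulr0.
  by rewrite ee'; case: (e); rewrite /sgn /=; ring.
have ff' : f' = f.
  have : (sgn K f - sgn K f') * w = 0.
    by transitivity ((v + sgn K f * w) + (- v - sgn K f' * w));
      [ring | rewrite E2 E4 addr0].
  rewrite we => /eqP; rewrite mulf_eq0 oppr_eq0 => /orP[|/eqP s0].
    by case: (f) (f') => [] [] //; rewrite /sgn ?opprK -?opprD ?oppr_eq0 -mulr2n pnatr_eq0.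
  by have := sgn_sqr e; rewrite s0 mul0r => /eqP; rewrite eq_sym oner_eq0.
split=> //.
  transitivity ((1 + u + sgn K e * w) - (1 - sgn K e * sgn K e)); first by rewrite we; ring.
  by rewrite E1 sgn_sqr !subrr.
by apply/eqP; rewrite -subr_eq0; apply/eqP; rewrite -[RHS]E2 we; ring.
Qed.

(** A linear form that vanishes on two distinct planes is zero. *)
Lemma two_planes (e e' : bool * bool) (u v w : K) : e != e' ->
  u + sgn K e.1 * w = 0 -> u + sgn K e'.1 * w = 0 ->
  v + sgn K e.2 * w = 0 -> v + sgn K e'.2 * w = 0 ->
  [/\ u = 0, v = 0 & w = 0].
Proof.
move=> ne E1 E1' E2 E2'.
have w0 : w = 0.
  have two0 : (2 : K) != 0 by rewrite pnatr_eq0.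
  apply: (mulfI two0); rewrite mulr0.
  move: e e' ne E1 E1' E2 E2' => [[] []] [[] []] //= _; rewrite /sgn => E1 E1' E2 E2';
  first [ transitivity ((u + 1 * w) - (u + -1 * w)); [ring | by rewrite ?E1 ?E1' subr0]
        | transitivity ((v + 1 * w) - (v + -1 * w)); [ring | by rewrite ?E2 ?E2' subr0]].
by move: E1 E2; rewrite w0 !mulr0 !addr0.
Qed.

(** Each plane is assigned a form [a ± c ± y]. If two planes share a form, that form is zero and the
    face 134 is flat. Otherwise all four forms occur, and opposite sign choices determine [c + y]
    and [c - y]: up to sign, [c] and [y] are then [x] and [b] in some order. *)
Lemma face_shape (y1 y2 y3 z1 z2 z3 c1 c2 c3 : K) :
  all_vanish y1 y2 y3 z1 z2 z3 c1 c2 c3 ->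
  [\/ exists d : bool * bool,
         [/\ 1 + sgn K d.1 * c1 + sgn K d.2 * y1 = 0,
             sgn K d.1 * c2 + sgn K d.2 * y2 = 0 &
             sgn K d.1 * c3 + sgn K d.2 * y3 = 0],
      exists s t : bool, [/\ c1 = 0, c2 = 0 & c3 = sgn K s] /\
                         [/\ y1 = 0, y2 = sgn K t & y3 = 0] |
      exists s t : bool, [/\ c1 = 0, c2 = sgn K s & c3 = 0] /\
                         [/\ y1 = 0, y2 = 0 & y3 = sgn K t]].
Proof.
move=> /flat_on_planes/fin_all_exists[d Hd].
have [injd|] := boolP (injectiveb d); last first.
  case/injectivePn=> e [e' ne eqd]; constructor 1; exists (d e).
  have [E1 E2] := Hd e; have := Hd e'; rewrite -{}eqd => -[E1' E2'].
  by have [] := two_planes ne E1 E1' E2 E2'; split.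
have [g dK gK] := injF_bij (injectiveP _ injd).
have key dd : let e := g dd in
    1 + sgn K dd.1 * c1 + sgn K dd.2 * y1
      + sgn K e.1 * (sgn K dd.1 * c3 + sgn K dd.2 * y3) = 0 /\
    sgn K dd.1 * c2 + sgn K dd.2 * y2
      + sgn K e.2 * (sgn K dd.1 * c3 + sgn K dd.2 * y3) = 0.
  by have := Hd (g dd); rewrite gK.
have injg : injective g := can_inj gK.
have := key (true, true); have := key (false, false).
have := key (true, false); have := key (false, true).
have : g (true, true) <> g (true, false) by move/injg.
have : g (false, false) <> g (true, false) by move/injg.
case: (g (true, true)) (g (false, false)) (g (true, false)) (g (false, true)).
move=> e1 f1 [e2 f2] [e3 f3] [e4 f4] /=.
move=> ne2 ne1 [D1 D2] [C1 C2] [B1 B2] [A1 A2].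
have [] := @opposite_planes e1 f1 e2 f2 (c1 + y1) (c2 + y2) (c3 + y3).
- by rewrite -[RHS]A1; ring.
- by rewrite -[RHS]A2; ring.
- by rewrite -[RHS]B1; ring.
- by rewrite -[RHS]B2; ring.
move=> ? ? u1 u2 u3; subst e2 f2.
have [] := @opposite_planes e3 f3 e4 f4 (c1 - y1) (c2 - y2) (c3 - y3).
- by rewrite -[RHS]C1; ring.
- by rewrite -[RHS]C2; ring.
- by rewrite -[RHS]D1; ring.
- by rewrite -[RHS]D2; ring.
move=> ? ? w1 w2 w3; subst e4 f4.
have cE (c y u w : K) : c + y = u -> c - y = w -> c + c = u + w /\ y + y = u - w.
  by move=> <- <-; split; ring.
have [cc1 yy1] := cE _ _ _ _ u1 w1; have [cc2 yy2] := cE _ _ _ _ u2 w2.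
have [cc3 yy3] := cE _ _ _ _ u3 w3.
(* The plane [(e3, f3)] differs from both [(e1, f1)] and [(~~ e1, f1)]. *)
have {ne1 ne2} ff : f3 = ~~ f1.
  by clear -ne1 ne2; case: f1 f3 e1 e3 ne1 ne2 => [] [] [] [].
have [ee|ee] := eqVneq e3 e1; [constructor 2 | constructor 3].
  exists (~~ e1), (f1 == e1); split; split; apply: eq_half;
    rewrite ?(cc1, cc2, cc3, yy1, yy2, yy3) ?ff ?ee;
    by case: (e1) (f1) => [] []; rewrite /sgn /=; ring.
have {}ee : e3 = ~~ e1 by case: (e1) (e3) ee => [] [].
exists (f1 == e1), (~~ e1); split; split; apply: eq_half;
  rewrite ?(cc1, cc2, cc3, yy1, yy2, yy3) ?ff ?ee;
  by case: (e1) (f1) => [] []; rewrite /sgn /=; ring.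
Qed.

(* When the face 134 is flat, F is a constant times the square of Stewart's relation. *)
Lemma flat_face (d : bool * bool) (y1 y2 y3 z1 z2 z3 c1 c2 c3 : K) :
  all_vanish y1 y2 y3 z1 z2 z3 c1 c2 c3 ->
  1 + sgn K d.1 * c1 + sgn K d.2 * y1 = 0 ->
  sgn K d.1 * c2 + sgn K d.2 * y2 = 0 -> sgn K d.1 * c3 + sgn K d.2 * y3 = 0 ->
  (exists s t : bool,
    [/\ [/\ c1 = 0, c2 = 0 & c3 = 0], [/\ y1 = sgn K s, y2 = 0 & y3 = 0] &
        [/\ z1 = 0, z2 = sgn K t & z3 = 0]]) \/
  (exists s t : bool,
    [/\ [/\ c1 = sgn K s, c2 = 0 & c3 = 0], [/\ y1 = 0, y2 = 0 & y3 = 0] &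
        [/\ z1 = 0, z2 = 0 & z3 = sgn K t]]).
Proof.
case: d => d1 d2 /= H F1 F2 F3.
have two0 : (2 : K) != 0 by rewrite pnatr_eq0.
have yE (v c y : K) : v + sgn K d1 * c + sgn K d2 * y = 0 -> y = - sgn K d2 * (v + sgn K d1 * c).
  move=> E; apply/eqP; rewrite -subr_eq0; apply/eqP.
  transitivity (sgn K d2 * (v + sgn K d1 * c + sgn K d2 * y)); last by rewrite E mulr0.
  by case: (d2); rewrite /sgn; ring.
have y1E := yE _ _ _ F1.
have y2E : y2 = - sgn K d2 * (0 + sgn K d1 * c2) by apply: yE; rewrite add0r.
have y3E : y3 = - sgn K d2 * (0 + sgn K d1 * c3) by apply: yE; rewrite add0r.
have S a b x : let c := c1 * a + c2 * b + c3 * x in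
    a * (b ^+ 2 + c ^+ 2 - (z1 * a + z2 * b + z3 * x) ^+ 2)
    + sgn K d1 * c * (a ^+ 2 + b ^+ 2 - x ^+ 2) = 0.
  apply/eqP; rewrite -sqrf_eq0; apply/eqP; apply: (mulfI two0).
  rewrite mulr0 -[RHS]oppr0 -(H a b x) y1E y2E y3E /cayley.
  by case: (d1) (d2) => [] []; rewrite /sgn; ring.
(* At [a = 0] Stewart's relation leaves only this product, so [c] is a multiple of [a]. *)
have cE i j : sgn K d1 * (c2 * i + c3 * j) * (i ^+ 2 - j ^+ 2) = 0.
  by rewrite -[RHS](S 0 i j); ring.
have s0 : sgn K d1 != 0.
  by apply/eqP => E; have /eqP := sgn_sqr d1; rewrite E mul0r eq_sym oner_eq0.
have c20 : c2 = 0.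
  by apply: (mulfI s0); rewrite mulr0 -[RHS](cE 1 0); ring.
have c30 : c3 = 0.
  by apply: (mulfI s0); rewrite mulr0 -[RHS]oppr0 -(cE 0 1); ring.
rewrite {yE cE}c20 {}c30 in S y2E y3E *.
have {F2 F3} y20 : y2 = 0 by rewrite y2E; ring.
have {y2E y3E} y30 : y3 = 0 by rewrite y3E; ring.
(* [k] is the signed ratio of [c] to [a]. At [a = 1] Stewart's relation says that
   [(z1 + z2 * b + z3 * x) ^+ 2] equals [k ^+ 2 + k + (1 + k) * b ^+ 2 - k * x ^+ 2]; the
   coefficients are compared through values at small integers. *)
pose k := sgn K d1 * c1.
have c1E : c1 = sgn K d1 * k by rewrite /k mulrA sgn_sqr mul1r.
have {}S b x : b ^+ 2 + k ^+ 2 - (z1 + z2 * b + z3 * x) ^+ 2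
    + k * (1 + b ^+ 2 - x ^+ 2) = 0.
  by rewrite -[RHS](S 1 b x) /k; case: (d1); rewrite /sgn; ring.
pose q b x := b ^+ 2 + k ^+ 2 - (z1 + z2 * b + z3 * x) ^+ 2 + k * (1 + b ^+ 2 - x ^+ 2).
have z11 : z1 ^+ 2 = k ^+ 2 + k.
  by apply/eqP; rewrite eq_sym -subr_eq0 -(S 0 0); apply/eqP; ring.
have four0 : (4 : K) != 0 by rewrite pnatr_eq0.
have z12 : z1 * z2 = 0.
  apply: (mulfI four0); rewrite mulr0; transitivity (q (-1) 0 - q 1 0);
    [by rewrite /q; ring | by rewrite /q !S subr0].
have z13 : z1 * z3 = 0.
  apply: (mulfI four0); rewrite mulr0; transitivity (q 0 (-1) - q 0 1);
    [by rewrite /q; ring | by rewrite /q !S subr0].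
have z22 : z2 ^+ 2 = 1 + k.
  apply/eqP; rewrite eq_sym -subr_eq0 -(S 1 0); apply/eqP.
  rewrite [RHS](_ : _ = 1 + k ^+ 2 - (z1 ^+ 2 + 2 * (z1 * z2) + z2 ^+ 2) + k * 2); last by ring.
  by rewrite z11 z12; ring.
have z33 : z3 ^+ 2 = - k.
  apply/eqP; rewrite eq_sym -subr_eq0 -(S 0 1); apply/eqP.
  rewrite [RHS](_ : _ = k ^+ 2 - (z1 ^+ 2 + 2 * (z1 * z3) + z3 ^+ 2)); last by ring.
  by rewrite z11 z13; ring.
have z23 : z2 * z3 = 0.
  apply: (mulfI two0); rewrite mulr0 -[RHS]oppr0 -(S 1 1).
  rewrite [RHS](_ : _ = - (1 + k ^+ 2 + k - (z1 ^+ 2 + z2 ^+ 2 + z3 ^+ 2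
    + 2 * (z1 * z2) + 2 * (z1 * z3) + 2 * (z2 * z3)))); last by ring.
  by rewrite z11 z22 z33 z12 z13; ring.
have sqrt1 (z : K) : z ^+ 2 = 1 -> exists t, z = sgn K t.
  by move/eqP; rewrite sqrf_eq1 => /orP[] /eqP ->; [exists true | exists false].
(* A square without mixed terms has at most one pure term. The value [k = -1] contracts the edge 13,
   and [k = 0] contracts 34. *)
have : (1 + k) * k == 0.
  by rewrite -oppr_eq0 -mulrN -z22 -z33 -exprMn z23 expr0n.
rewrite mulf_eq0 addrC addr_eq0 => /orP[] /eqP kE; rewrite kE in z11 z22 z33 c1E; [right|left].
  have [t z3t] : exists t, z3 = sgn K t by apply: sqrt1; rewrite z33 opprK.
  exists (~~ d1), t; split; split=> //.
  - by rewrite c1E; case: (d1); rewrite /sgn /=; ring.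
  - by rewrite y1E -/k kE subrr mulr0.
  - by apply/eqP; rewrite -sqrf_eq0 z11 sqrrN expr1n subrr.
  - by apply/eqP; rewrite -sqrf_eq0 z22 subrr.
have [t z2t] : exists t, z2 = sgn K t by apply: sqrt1; rewrite z22 addr0.
exists (~~ d2), t; split; split=> //.
- by rewrite c1E mulr0.
- by rewrite y1E -/k kE addr0 mulr1; case: (d2); rewrite /sgn /= ?opprK.
- by apply/eqP; rewrite -sqrf_eq0 z11 expr0n addr0.
- by apply/eqP; rewrite -sqrf_eq0 z33 oppr0.
Qed.

(** [face_shape] is applied to the faces 134 and 234. The outcomes contract the edges 34, 13 and 23,
    in this order. *)
Lemma triangle_forms (y1 y2 y3 z1 z2 z3 c1 c2 c3 : K) :
  all_vanish y1 y2 y3 z1 z2 z3 c1 c2 c3 ->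
  [\/ exists s t : bool,
       [/\ [/\ c1 = 0, c2 = 0 & c3 = 0], [/\ y1 = sgn K s, y2 = 0 & y3 = 0] &
           [/\ z1 = 0, z2 = sgn K t & z3 = 0]],
      exists s t : bool,
       [/\ [/\ c1 = sgn K s, c2 = 0 & c3 = 0], [/\ y1 = 0, y2 = 0 & y3 = 0] &
           [/\ z1 = 0, z2 = 0 & z3 = sgn K t]] |
      exists s t : bool,
       [/\ [/\ c1 = 0, c2 = sgn K s & c3 = 0], [/\ y1 = 0, y2 = 0 & y3 = sgn K t] &
           [/\ z1 = 0, z2 = 0 & z3 = 0]]].
Proof.
move=> H; have H' := all_vanish_swap H.
have sN0 s : sgn K s <> 0.
  by move=> E; have /eqP := sgn_sqr s; rewrite E mul0r eq_sym oner_eq0.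
case: (face_shape H) => [[d [D1 D2 D3]]||].
- by case: (flat_face H D1 D2 D3); [constructor 1 | constructor 2].
- move=> [s [t [[c10 c20 c3s] [y10 y2t y30]]]].
  case: (face_shape H') => [[d [D1 D2 D3]]||].
  + by case: (flat_face H' D1 D2 D3) => -[s' [t' [[_ _ c30] _ _]]]; case: (sN0 s); rewrite -c3s.
  + move=> [s' [t' [_ [z20 z1t z30]]]].
    (* Opposite edges are equal up to sign, so this point is a regular tetrahedron with edges ±1. *)
    have := H 1 1 1; rewrite c10 c20 c3s y10 y2t y30 z20 z1t z30 => /eqP.
    rewrite (_ : cayley _ _ _ _ _ _ = 4).
      by rewrite pnatr_eq0.
    by rewrite /cayley; case: (s) (t) (t') => [] [] []; rewrite /sgn; ring.
  + by move=> [s' [t' [[_ _ c30] _]]]; case: (sN0 s); rewrite -c3s.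
- move=> [s [t [[c10 c2s c30] [y10 y20 y3t]]]].
  case: (face_shape H') => [[d [D1 D2 D3]]||].
  + case: (flat_face H' D1 D2 D3) => -[s' [t' [[C1 C2 C3] [Y1 Y2 Y3] [Z1 Z2 Z3]]]].
      by case: (sN0 s); rewrite -c2s.
    by constructor 3; exists s', t'.
  + by move=> [s' [t' [[_ _ c3s] _]]]; case: (sN0 s'); rewrite -c3s.
  + by move=> [s' [t' [[c2s' _ _] _]]]; case: (sN0 s); rewrite -c2s.
Qed.

End Triangle.

(** * Linear forms with an independent star or path *)

Section StarAndPath.
Variable K : numFieldType.

(** On the plane where the edge 34 is zero, the determinant is [2 * a ^+ 2 * b ^+ 2] times a
    quadratic form, whose value at [a = 1], [b = t] is [E t] in the proof. Its values at 1, -1 and 2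
    yield the three coefficients. *)
Lemma star_plane (x1 x2 y1 z2 : K) :
  (forall a b, cayley (x1 * a + x2 * b) (y1 * a) a (z2 * b) b 0 = 0) ->
  (y1 ^+ 2 = 1 /\ z2 ^+ 2 = 1) \/
  [/\ x1 = 0, x2 = 0, y1 ^+ 2 <> 1 & z2 ^+ 2 <> 1].
Proof.
move=> H.
have two0 : (2 : K) != 0 by rewrite pnatr_eq0.
have three0 : (3 : K) != 0 by rewrite pnatr_eq0.
pose P := 1 - y1 ^+ 2; pose Q := 1 - z2 ^+ 2.
pose E t := (1 + t ^+ 2 - (x1 + x2 * t) ^+ 2) * P * Q - t ^+ 2 * Q ^+ 2 - P ^+ 2.
have E0 t : t != 0 -> E t = 0.
  move=> t0; apply: (mulfI (mulf_neq0 two0 (mulf_neq0 t0 t0))).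
  by rewrite mulr0 -[RHS](H 1 t) /E /P /Q /cayley; ring.
have Ep : E 1 = 0 by apply: E0; rewrite oner_eq0.
have Em : E (-1) = 0 by apply: E0; rewrite oppr_eq0 oner_eq0.
have E2 : E 2 = 0 by exact: E0.
have cross : x1 * x2 * P * Q = 0.
  apply: (mulfI (mulf_neq0 two0 two0)); rewrite mulr0.
  by transitivity (E (-1) - E 1); [rewrite /E; ring | rewrite Ep Em subrr].
have sqb : Q * ((1 - x2 ^+ 2) * P - Q) = 0.
  apply: (mulfI (mulf_neq0 two0 three0)); rewrite mulr0.
  transitivity (2 * E 2 - E (-1) - E 1 + 8 * (x1 * x2 * P * Q)).
    by rewrite /E; ring.
  by rewrite Ep Em E2 cross !mulr0 !subr0 addr0.
have sqa : P * ((1 - x1 ^+ 2) * Q - P) = 0.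
  apply: (mulfI two0); rewrite mulr0.
  transitivity (E (-1) + E 1 - 2 * (Q * ((1 - x2 ^+ 2) * P - Q))).
    by rewrite /E; ring.
  by rewrite Ep Em sqb mulr0 subr0 addr0.
have sq1 (v : K) : 1 - v ^+ 2 = 0 -> v ^+ 2 = 1.
  by move/eqP; rewrite subr_eq0 => /eqP.
have [P0|P0] := eqVneq P 0.
  left; split; apply: sq1 => //; apply/eqP; rewrite -/Q.
  by move/eqP: sqb; rewrite P0 mulr0 sub0r mulrN oppr_eq0 -expr2 sqrf_eq0.
move/eqP: sqa; rewrite mulf_eq0 (negbTE P0) subr_eq0 /= => /eqP PE.
have Q0 : Q != 0 by apply: contra_neq P0 => Q0; rewrite -PE Q0 mulr0.
move/eqP: sqb; rewrite mulf_eq0 (negbTE Q0) subr_eq0 /= => /eqP QE.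
have x0 (v p : K) : p != 0 -> (1 - v ^+ 2) * p = p -> v = 0.
  move=> p0 vp; apply/eqP; rewrite -sqrf_eq0; apply/eqP; apply: (mulIf p0).
  by transitivity (p - (1 - v ^+ 2) * p); [ring | rewrite vp subrr mul0r].
right; split; last 2 first.
- by move=> E1; move: P0; rewrite /P E1 subrr eqxx.
- by move=> E1; move: Q0; rewrite /Q E1 subrr eqxx.
- move/eqP: cross; rewrite !mulf_eq0 (negbTE P0) (negbTE Q0) !orbF => /orP[/eqP //|/eqP x20].
  by apply: (x0 _ P) => //; rewrite -{2}PE -QE x20 expr0n subr0 mul1r.
- move/eqP: cross; rewrite !mulf_eq0 (negbTE P0) (negbTE Q0) !orbF => /orP[/eqP x10|/eqP //].
  by apply: (x0 _ Q) => //; rewrite -{2}QE -PE x10 expr0n subr0 mul1r.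
Qed.

(** Each edge of the star is set to zero in turn. Any two of the three planes share a coefficient
    that is zero in one alternative and a sign in the other, so all three choose alike. *)
Lemma star_forms (x1 x2 y1 y3 z2 z3 : K) :
  (forall a b c, cayley (x1 * a + x2 * b) (y1 * a + y3 * c) a
                   (z2 * b + z3 * c) b c = 0) ->
  [/\ x1 = 0 /\ x2 = 0, y1 = 0 /\ y3 = 0 & z2 = 0 /\ z3 = 0] \/
  [/\ x1 ^+ 2 = 1 /\ x2 ^+ 2 = 1, y1 ^+ 2 = 1 /\ y3 ^+ 2 = 1 &
      z2 ^+ 2 = 1 /\ z3 ^+ 2 = 1].
Proof.
move=> H.
have Hc : forall a b, cayley (x1 * a + x2 * b) (y1 * a) a (z2 * b) b 0 = 0.
  by move=> a b; rewrite -[RHS](H a b 0) /cayley; ring.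
have Ha : forall c b, cayley (z3 * c + z2 * b) (y3 * c) c (x2 * b) b 0 = 0.
  by move=> c b; rewrite -[RHS](H 0 b c) /cayley; ring.
have Hb : forall a c, cayley (y1 * a + y3 * c) (x1 * a) a (z3 * c) c 0 = 0.
  by move=> a c; rewrite -[RHS](H a 0 c) /cayley; ring.
have n01 : (0 : K) ^+ 2 <> 1 by move/eqP; rewrite expr0n eq_sym oner_eq0.
case: (star_plane Hc) (star_plane Ha) (star_plane Hb) =>
  [[? ?]|[x10 x20 ? ?]] [[? ?]|[z30 z20 ? ?]] [[? ?]|[y10 y30 ? ?]]; subst => //;
  by [left | right].
Qed.

(** At [z = 0] the square of [a1 * x + a3 * c] would have to be [x ^+ 2 + c ^+ 2], which is not the
    square of a linear form. *)
Lemma path_forms (a1 a2 a3 b2 y2 : K) :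
  ~ (forall x z c, cayley x (y2 * z) (a1 * x + a2 * z + a3 * c) z (b2 * z) c = 0).
Proof.
move=> H.
have two0 : (2 : K) != 0 by rewrite pnatr_eq0.
have E c : c != 0 -> (a1 + a3 * c) ^+ 2 - 1 - c ^+ 2 = 0.
  move=> c0; apply: (mulfI (mulf_neq0 two0 (mulf_neq0 c0 c0))).
  by rewrite mulr0 -[RHS](H 1 0 c) /cayley; ring.
have Ep : (a1 + a3 * 1) ^+ 2 - 1 - 1 ^+ 2 = 0 by apply: E; rewrite oner_eq0.
have Em : (a1 + a3 * -1) ^+ 2 - 1 - (-1) ^+ 2 = 0.
  by apply: E; rewrite oppr_eq0 oner_eq0.
have E2 : (a1 + a3 * 2) ^+ 2 - 1 - 2 ^+ 2 = 0 by apply: E.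
pose e c := (a1 + a3 * c) ^+ 2 - 1 - c ^+ 2.
have a13 : a1 * a3 = 0.
  apply: (mulfI (mulf_neq0 two0 two0)); rewrite mulr0.
  by transitivity (e 1 - e (-1)); [rewrite /e; ring | rewrite /e Ep Em subrr].
have three0 : (3 : K) != 0 by rewrite pnatr_eq0.
have a33 : a3 ^+ 2 - 1 = 0.
  apply: (mulfI (mulf_neq0 two0 three0)); rewrite mulr0.
  transitivity (2 * e 2 - e (-1) - e 1 - 8 * (a1 * a3)); first by rewrite /e; ring.
  by rewrite /e Ep Em E2 a13 !mulr0 !subr0.
have a11 : a1 ^+ 2 - 1 = 0.
  apply: (mulfI two0); rewrite mulr0.
  transitivity (e (-1) + e 1 - 2 * (a3 ^+ 2 - 1)); first by rewrite /e; ring.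
  by rewrite /e Ep Em a33 !mulr0 !subr0 addr0.
move/eqP: a13; rewrite mulf_eq0 => /orP[] /eqP z.
  by move/eqP: a11; rewrite z expr0n sub0r oppr_eq0 oner_eq0.
by move/eqP: a33; rewrite z expr0n sub0r oppr_eq0 oner_eq0.
Qed.

End StarAndPath.

(** * Determinants of order three *)

Local Notation o0 := (ord0 : 'I_3).
Local Notation o1 := (lift ord0 ord0 : 'I_3).
Local Notation o2 := (lift ord0 (lift ord0 ord0) : 'I_3).

Lemma ord3P (P : 'I_3 -> Prop) : P o0 -> P o1 -> P o2 -> forall i, P i.
Proof.
move=> P0 P1 P2 [[|[|[|//]]] lti].
- by rewrite (_ : Ordinal lti = o0) //; apply: val_inj.
- by rewrite (_ : Ordinal lti = o1) //; apply: val_inj.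
- by rewrite (_ : Ordinal lti = o2) //; apply: val_inj.
Qed.

Lemma det_mx33 (R : comNzRingType) (M : 'M[R]_3) : \det M =
  M o0 o0 * (M o1 o1 * M o2 o2 - M o1 o2 * M o2 o1)
  - M o0 o1 * (M o1 o0 * M o2 o2 - M o1 o2 * M o2 o0)
  + M o0 o2 * (M o1 o0 * M o2 o1 - M o1 o1 * M o2 o0).
Proof.
have l1 : lift o1 (ord0 : 'I_2) = o0 by apply: val_inj.
have l2 : lift o2 (ord0 : 'I_2) = o0 by apply: val_inj.
have l3 : lift o1 (lift ord0 ord0 : 'I_2) = o2 by apply: val_inj.
have l4 : lift o2 (lift ord0 ord0 : 'I_2) = o1 by apply: val_inj.
have l5 : lift (lift ord0 ord0 : 'I_2) (ord0 : 'I_1) = (ord0 : 'I_2).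
  by apply: val_inj.
rewrite (expand_det_row _ ord0) !big_ord_recl big_ord0 /cofactor.
rewrite !(expand_det_row _ (ord0 : 'I_2)) !big_ord_recl !big_ord0.
rewrite /cofactor !det_mx11 !mxE ?l5 ?l1 ?l2 ?l3 ?l4 /=.
by ring.
Qed.

(** * Six linear forms in three variables, indexed by the edges *)

Section Forms.
Variable K : numFieldType.
Implicit Types (f g h : 'rV[K]_3) (D : 'I_4 -> 'I_4 -> 'rV[K]_3).

Definition frame f g h : 'M[K]_3 := \matrix_(i < 3) nth 0 [:: f; g; h] i.

Lemma det_frame f g h : \det (frame f g h) =
  f 0 o0 * (g 0 o1 * h 0 o2 - g 0 o2 * h 0 o1)
  - f 0 o1 * (g 0 o0 * h 0 o2 - g 0 o2 * h 0 o0)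
  + f 0 o2 * (g 0 o0 * h 0 o1 - g 0 o1 * h 0 o0).
Proof. by rewrite det_mx33 !mxE. Qed.

Lemma frameM f g h (N : 'M[K]_3) :
  frame (f *m N) (g *m N) (h *m N) = frame f g h *m N.
Proof. by apply/row_matrixP; apply: ord3P; rewrite row_mul !rowK. Qed.

(** This change of coordinates turns three independent forms into the coordinate forms. *)
Lemma frame_dual f g h : \det (frame f g h) != 0 ->
  exists2 N : 'M[K]_3, N \in unitmx &
    [/\ f *m N = delta_mx 0 o0, g *m N = delta_mx 0 o1 & h *m N = delta_mx 0 o2].
Proof.
move=> d0; have uF : frame f g h \in unitmx by rewrite unitmxE unitfE.
exists (invmx (frame f g h)); first by rewrite unitmx_inv.
have rE i : row i (frame f g h) *m invmx (frame f g h) = delta_mx 0 i.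
  by rewrite -row_mul mulmxV // row1.
by split; rewrite -rE rowK.
Qed.

Definition value f (t : 'cV[K]_3) : K := (f *m t) 0 0.

Lemma valueE f (a b c : K) :
  value f (\col_i nth 0 [:: a; b; c] i) = f 0 o0 * a + f 0 o1 * b + f 0 o2 * c.
Proof. by rewrite /value mxE !big_ord_recl big_ord0 !mxE addr0 addrA. Qed.

(** Quantifying over all labellings of the vertices lets the cases below relabel freely. *)
Definition degenerate D : Prop :=
  (forall i j, D i j = D j i) /\
  forall i j k l, uniq [:: i; j; k; l] -> forall t,
    cayley (value (D i j) t) (value (D i k) t) (value (D i l) t)
           (value (D j k) t) (value (D j l) t) (value (D k l) t) = 0.

(* The three kinds of components, in the order of [is_sing_component]; for the first
   one, the forms are differences of points of a line, up to sign. *)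
Definition collinear D : Prop := exists p : 'I_4 -> 'rV[K]_3,
  forall i j, i != j -> D i j = p i - p j \/ D i j = - (p i - p j).

Definition edge_contracted D : Prop := exists a b c e, uniq [:: a; b; c; e] /\
  [/\ D a b = 0, D a c = D b c \/ D a c = - D b c
    & D a e = D b e \/ D a e = - D b e].

Definition face_contracted D : Prop := exists a b c, uniq [:: a; b; c] /\
  [/\ D a b = 0, D a c = 0 & D b c = 0].

Definition singular D : Prop :=
  [\/ collinear D, edge_contracted D | face_contracted D].

Lemma degenerateM D (N : 'M[K]_3) :
  degenerate D -> degenerate (fun i j => D i j *m N).
Proof.
case=> Dsym Dvan; split=> [i j|i j k l ijkl t]; first by rewrite Dsym.
by rewrite -[RHS](Dvan i j k l ijkl (N *m t)) /value !mulmxA.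
Qed.

Lemma singularM D (N : 'M[K]_3) : N \in unitmx ->
  singular (fun i j => D i j *m N) -> singular D.
Proof.
move=> uN; have inj f g : f *m N = g *m N -> f = g.
  by move=> E; rewrite -(mulmxK uN f) E mulmxK.
have inj0 f : f *m N = 0 -> f = 0 by move=> E; apply: inj; rewrite E mul0mx.
have injS f g : f *m N = g *m N \/ f *m N = - (g *m N) -> f = g \/ f = - g.
  by rewrite -mulNmx => -[/inj|/inj]; [left|right].
case=> [[p Hp]|[a [b [c [e [u [/inj0 ? /injS ? /injS ?]]]]]]
       |[a [b [c [u [/inj0 ? /inj0 ? /inj0 ?]]]]]].
- constructor 1; exists (fun i => p i *m invmx N) => i j /Hp.
  by rewrite -mulmxBl => H; apply: injS; rewrite mulmxKV.
- by constructor 2; exists a, b, c, e.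
- by constructor 3; exists a, b, c.
Qed.

Lemma row3P f g : f 0 o0 = g 0 o0 -> f 0 o1 = g 0 o1 -> f 0 o2 = g 0 o2 -> f = g.
Proof. by move=> *; apply/rowP; apply: ord3P. Qed.

Lemma delta3E :
  [/\ delta_mx 0 o0 = \row_i nth 0 [:: 1; 0; 0] i :> 'rV[K]_3,
      delta_mx 0 o1 = \row_i nth 0 [:: 0; 1; 0] i :> 'rV[K]_3 &
      delta_mx 0 o2 = \row_i nth 0 [:: 0; 0; 1] i :> 'rV[K]_3].
Proof. by split; apply: row3P; rewrite !mxE. Qed.

Lemma uniq4_cases (i j k l : 'I_4) : uniq [:: i; j; k; l] ->
  forall m, [\/ m = i, m = j, m = k | m = l].
Proof.
move=> u m; have : m \in [:: i; j; k; l].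
  have sub : {subset [:: i; j; k; l] <= enum 'I_4} by move=> x; rewrite mem_enum.
  by have [|_ ->] := uniq_min_size u sub; rewrite ?mem_enum // size_enum_ord.
by rewrite !inE => /or4P[] /eqP; [constructor 1|constructor 2|constructor 3|constructor 4].
Qed.

Lemma sgn_cases (s : bool) f g : g = sgn K s *: f -> f = g \/ f = - g.
Proof. by case: s => ->; rewrite /sgn ?scale1r ?scaleN1r ?opprK; [left|right]. Qed.

Lemma sqr1_cases (c : K) f g : c ^+ 2 = 1 -> f = c *: g -> f = g \/ f = - g.
Proof.
by move=> /eqP; rewrite sqrf_eq1 => /orP[] /eqP -> ->;
  rewrite ?scale1r ?scaleN1r; [left|right].
Qed.

Lemma triangle_case D i j k l : degenerate D -> uniq [:: i; j; k; l] ->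
  \det (frame (D i k) (D j k) (D i j)) != 0 -> singular D.
Proof.
move=> degD uijkl /frame_dual[N uN [Eik Ejk Eij]]; apply: (singularM uN).
have {degD} := degenerateM N degD; set D' := fun m n => D m n *m N.
rewrite -[D i k *m N]/(D' i k) in Eik; rewrite -[D j k *m N]/(D' j k) in Ejk.
rewrite -[D i j *m N]/(D' i j) in Eij; clearbody D' => -[D'C D'0].
have [d0 d1 d2] := delta3E.
(* The vertices 1, 2, 3, 4 of [all_vanish] are [i], [j], [l], [k]. *)
have uijlk : uniq [:: i; j; l; k].
  by rewrite -(perm_uniq (s1 := [:: i; j; k; l])) // !perm_cons (perm_catC [:: k]).
have H : all_vanish (D' i l 0 o0) (D' i l 0 o1) (D' i l 0 o2)
    (D' j l 0 o0) (D' j l 0 o1) (D' j l 0 o2) (D' k l 0 o0) (D' k l 0 o1) (D' k l 0 o2).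
  move=> a b x; have := D'0 _ _ _ _ uijlk (\col_m nth 0 [:: a; b; x] m).
  rewrite !valueE (D'C l k) Eik Ejk Eij d0 d1 d2 !mxE /=.
  by rewrite !(mul0r, mul1r, add0r, addr0).
have perm4 a b c e : perm_eq [:: i; j; k; l] [:: a; b; c; e] -> uniq [:: a; b; c; e].
  by move/perm_uniq <-.
have E (d f : 'rV[K]_3) (s : bool) (u : seq K) : d = \row_m nth 0 u m ->
    f 0 o0 = sgn K s * nth 0 u 0 -> f 0 o1 = sgn K s * nth 0 u 1 ->
    f 0 o2 = sgn K s * nth 0 u 2 -> d = f \/ d = - f.
  by move=> -> *; apply: (@sgn_cases s); apply: row3P; rewrite !mxE.
have simp := (mulr0, mulr1).
case: (triangle_forms H) => -[s [t [[K0 K1 K2] [I0 I1 I2] [J0 J1 J2]]]]; constructor 2.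
- exists k, l, i, j; split; first by apply: perm4; apply/permP => q /=; lia.
  rewrite (D'C k i) (D'C l i) (D'C k j) (D'C l j) Eik Ejk; split.
  + by apply: row3P; rewrite mxE.
  + by apply: (E _ _ s _ d0); rewrite /= simp.
  + by apply: (E _ _ t _ d1); rewrite /= simp.
- exists i, l, k, j; split; first by apply: perm4; apply/permP => q /=; lia.
  rewrite (D'C l k) (D'C l j) Eik Eij; split.
  + by apply: row3P; rewrite mxE.
  + by apply: (E _ _ s _ d0); rewrite /= simp.
  + by apply: (E _ _ t _ d2); rewrite /= simp.
- exists j, l, k, i; split; first by apply: perm4; apply/permP => q /=; lia.
  rewrite (D'C l k) (D'C l i) (D'C j i) Ejk Eij; split.
  + by apply: row3P; rewrite mxE.
  + by apply: (E _ _ s _ d1); rewrite /= simp.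
  + by apply: (E _ _ t _ d2); rewrite /= simp.
Qed.

(** The dependent faces at [l] make each edge of the base a combination of two edges of the star, as
    [star_forms] requires. The dependent base makes the signs compatible with points on a line. *)
Lemma star_case D i j k l : degenerate D -> uniq [:: i; j; k; l] ->
  \det (frame (D i l) (D j l) (D i j)) = 0 ->
  \det (frame (D i l) (D k l) (D i k)) = 0 ->
  \det (frame (D j l) (D k l) (D j k)) = 0 ->
  \det (frame (D i k) (D j k) (D i j)) = 0 ->
  \det (frame (D i l) (D j l) (D k l)) != 0 -> singular D.
Proof.
move=> degD uijkl T1 T2 T3 T4 /frame_dual[N uN [Eil Ejl Ekl]]; apply: (singularM uN).
have frame0 f g h : \det (frame f g h) = 0 ->
    \det (frame (f *m N) (g *m N) (h *m N)) = 0.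
  by move=> E; rewrite frameM det_mulmx E mul0r.
move/frame0: T1; move/frame0: T2; move/frame0: T3; move/frame0: T4.
have {degD} := degenerateM N degD; set D' := fun m n => D m n *m N.
rewrite -[D i l *m N]/(D' i l) in Eil *; rewrite -[D j l *m N]/(D' j l) in Ejl *.
rewrite -[D k l *m N]/(D' k l) in Ekl *.
rewrite -[D i j *m N]/(D' i j) -[D i k *m N]/(D' i k) -[D j k *m N]/(D' j k).
clearbody D' => -[D'C D'0].
have [d0 d1 d2] := delta3E.
rewrite !det_frame Eil Ejl Ekl d0 d1 d2 !mxE /=.
rewrite !(mul0r, mul1r, mulr0, mulr1, add0r, addr0, subr0, sub0r, opprK).
move=> T4 T3 /eqP; rewrite oppr_eq0 => /eqP T2 T1.
rewrite T1 T2 T3 in T4.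
set x := D' i j in T1 T4 *; set y := D' i k in T2 T4 *; set z := D' j k in T3 T4 *.
have := @star_forms K (x 0 o0) (x 0 o1) (y 0 o0) (y 0 o2) (z 0 o1) (z 0 o2).
case=> [a b c||].
- have := D'0 _ _ _ _ uijkl (\col_m nth 0 [:: a; b; c] m).
  rewrite !valueE -/x -/y -/z Eil Ejl Ekl d0 d1 d2 !mxE /= T1 T2 T3.
  by rewrite !(mul0r, mul1r, add0r, addr0).
- case=> -[x0 x1] [y0 y2] [z1 z2]; constructor 3; exists i, j, k; split.
    by move: uijkl; rewrite (uniq_catC [:: i; j; k] [:: l]) /= => /andP[].
  by split; apply: row3P; rewrite mxE.
- case=> -[x0 x1] [y0 y2] [z1 z2]; constructor 1.
  (* With [l] at the origin and [i] at the first coordinate form, the edges [x] and [y] fix the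
     signs of the points [j] and [k]. *)
  pose p m : 'rV[K]_3 := if m == i then delta_mx 0 o0
    else if m == j then - (x 0 o0 * x 0 o1) *: delta_mx 0 o1
    else if m == k then - (y 0 o0 * y 0 o2) *: delta_mx 0 o2 else 0.
  exists p.
  have [pi pj pk pl] : [/\ p i = delta_mx 0 o0,
      p j = - (x 0 o0 * x 0 o1) *: delta_mx 0 o1,
      p k = - (y 0 o0 * y 0 o2) *: delta_mx 0 o2 & p l = 0].
    move: uijkl; rewrite /= !inE !negb_or /p !eqxx.
    case/and4P=> /and3P[nij nik nil] /andP[njk njl] nkl _.
    rewrite (eq_sym j i) (eq_sym k i) (eq_sym l i) (eq_sym k j) (eq_sym l j) (eq_sym l k).
    by rewrite !ifN.
  pose P m n := D' m n = p m - p n \/ D' m n = - (p m - p n).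
  have PC m n : P m n -> P n m.
    by rewrite /P D'C => -[] ->; rewrite opprB; [right|left]; rewrite ?opprB.
  have Pij : P i j.
    apply: (@sqr1_cases (x 0 o0)); rewrite // -/x pi pj.
    apply: row3P; rewrite d0 d1 !mxE /=; [ring| |by rewrite T1; ring].
    by transitivity (x 0 o0 ^+ 2 * x 0 o1); [rewrite x0 mul1r | ring].
  have Pik : P i k.
    apply: (@sqr1_cases (y 0 o0)); rewrite // -/y pi pk.
    apply: row3P; rewrite d0 d2 !mxE /=; [ring|by rewrite T2; ring|].
    by transitivity (y 0 o0 ^+ 2 * y 0 o2); [rewrite y0 mul1r | ring].
  have Pil : P i l by left; rewrite Eil pi pl subr0.
  have Pjl : P j l.
    apply/PC/(@sqr1_cases (x 0 o0 * x 0 o1)); first by rewrite exprMn x0 x1 mulr1.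
    rewrite D'C Ejl pj pl sub0r scaleNr opprK scalerA.
    by rewrite -expr2 exprMn x0 x1 mulr1 scale1r.
  have Pkl : P k l.
    apply/PC/(@sqr1_cases (y 0 o0 * y 0 o2)); first by rewrite exprMn y0 y2 mulr1.
    rewrite D'C Ekl pk pl sub0r scaleNr opprK scalerA.
    by rewrite -expr2 exprMn y0 y2 mulr1 scale1r.
  have Pjk : P j k.
    apply: (@sqr1_cases (- (x 0 o0 * x 0 o1 * z 0 o1))).
      by rewrite sqrrN !exprMn x0 x1 z1 !mulr1.
    (* The dependence [T4] of the base ties the two signs in [z] together. *)
    have zE : z 0 o2 = - (x 0 o0 * x 0 o1 * (y 0 o0 * y 0 o2) * z 0 o1).
      transitivity (x 0 o1 ^+ 2 * y 0 o0 ^+ 2 * z 0 o2); first by rewrite x1 y0 !mul1r.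
      apply/eqP; rewrite -subr_eq0; apply/eqP.
      by rewrite -[RHS](mulr0 (- (x 0 o1 * y 0 o0))) -T4; ring.
    rewrite -/z pj pk; apply: row3P; rewrite d1 d2 !mxE /= ?T3; [ring| |].
      by transitivity (x 0 o0 ^+ 2 * x 0 o1 ^+ 2 * z 0 o1); [rewrite x0 x1 !mul1r | ring].
    by rewrite zE; ring.
  move=> m n; have [] := uniq4_cases uijkl m; have [] := uniq4_cases uijkl n => -> ->;
    rewrite ?eqxx // => _; by [|apply: PC].
Qed.

(** If the path were independent, [D i k] would lie in the span of [D i j], [D j k] by the triangle
    and in that of [D j k], [D k l] by the star at [k], hence be a multiple of [D j k]. So would
    [D j l], against [path_forms]. *)
Lemma path_case D i j k l : degenerate D -> uniq [:: i; j; k; l] ->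
  \det (frame (D i k) (D j k) (D i j)) = 0 ->
  \det (frame (D i k) (D j k) (D l k)) = 0 ->
  \det (frame (D j k) (D l k) (D j l)) = 0 ->
  \det (frame (D i j) (D k j) (D l j)) = 0 ->
  \det (frame (D i j) (D j k) (D k l)) = 0.
Proof.
move=> degD uijkl T1 T2 T3 T4; apply: contraTeq isT => /frame_dual[N uN [Eij Ejk Ekl]].
have frame0 f g h : \det (frame f g h) = 0 ->
    \det (frame (f *m N) (g *m N) (h *m N)) = 0.
  by move=> E; rewrite frameM det_mulmx E mul0r.
move/frame0: T1; move/frame0: T2; move/frame0: T3; move/frame0: T4.
have {degD} := degenerateM N degD; set D' := fun m n => D m n *m N.
rewrite -[D i j *m N]/(D' i j) in Eij *; rewrite -[D j k *m N]/(D' j k) in Ejk *.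
rewrite -[D k l *m N]/(D' k l) in Ekl *.
rewrite -[D i k *m N]/(D' i k) -[D l k *m N]/(D' l k) -[D j l *m N]/(D' j l).
rewrite -[D k j *m N]/(D' k j) -[D l j *m N]/(D' l j).
clearbody D' => -[D'C D'0]; rewrite (D'C l k) (D'C k j) (D'C l j).
have [d0 d1 d2] := delta3E.
rewrite !det_frame Eij Ejk Ekl d0 d1 d2 !mxE /=.
rewrite !(mul0r, mul1r, mulr0, mulr1, add0r, addr0, subr0, sub0r, opprK, oppr0, mulrN1).
move=> b2 b0 y0 /eqP; rewrite oppr_eq0 => /eqP y2.
case: (@path_forms K (D' i l 0 o0) (D' i l 0 o1) (D' i l 0 o2) (D' j l 0 o1) (D' i k 0 o1)).
move=> x z c; have := D'0 _ _ _ _ uijkl (\col_m nth 0 [:: x; z; c] m).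
rewrite !valueE Eij Ejk Ekl d0 d1 d2 !mxE /= b0 b2 y0 y2.
by rewrite !(mul0r, mul1r, add0r, addr0).
Qed.

Lemma det_frameC12 f g h : \det (frame f g h) = 0 -> \det (frame g f h) = 0.
Proof. by move=> E; rewrite -[RHS]oppr0 -E !det_frame; ring. Qed.

Lemma det_frameC23 f g h : \det (frame f g h) = 0 -> \det (frame f h g) = 0.
Proof. by move=> E; rewrite -[RHS]oppr0 -E !det_frame; ring. Qed.

Lemma det_frame_sorted (E : seq 'rV[K]_3) :
  (forall p q r, (p < q < r)%N -> (r < size E)%N ->
     \det (frame E`_p E`_q E`_r) = 0) ->
  forall p q r, (p < size E)%N -> (q < size E)%N -> (r < size E)%N ->
     \det (frame E`_p E`_q E`_r) = 0.
Proof.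
move=> H p q r pE qE rE.
have eq12 f h : \det (frame f f h) = 0 by rewrite det_frame; ring.
have eq23 f h : \det (frame f h h) = 0 by rewrite det_frame; ring.
have [pq|qp|<-//] := ltngtP p q; have [qr|rq|<-//] := ltngtP q r.
- by apply: H; rewrite ?pq.
- apply: det_frameC23; have [pr|rp|<-//] := ltngtP p r.
    by apply: H; rewrite ?pr.
  by apply: det_frameC12; apply: H; rewrite ?rp.
- apply: det_frameC12; have [pr|rp|<-//] := ltngtP p r.
    by apply: H; rewrite ?qp.
  by apply: det_frameC23; apply: H; rewrite ?qr.
- apply/det_frameC12/det_frameC23/det_frameC12.
  by apply: H; rewrite ?rq.
Qed.

(** The order matters: stars are treated once all triangles are dependent, and paths after both. *)
Lemma nonsingular_dependent D i j k l : degenerate D -> ~ singular D ->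
  uniq [:: i; j; k; l] ->
  [/\ \det (frame (D i k) (D j k) (D i j)) = 0,
      \det (frame (D i l) (D j l) (D k l)) = 0 &
      \det (frame (D i j) (D j k) (D k l)) = 0].
Proof.
move=> degD nS uijkl.
have perm4 a b c e : perm_eq [:: i; j; k; l] [:: a; b; c; e] -> uniq [:: a; b; c; e].
  by move/perm_uniq <-.
have T a b c e : uniq [:: a; b; c; e] -> \det (frame (D a c) (D b c) (D a b)) = 0.
  by move=> u; apply/eqP; apply: contra_notT nS; exact: (triangle_case degD u).
have S a b c e : uniq [:: a; b; c; e] -> \det (frame (D a e) (D b e) (D c e)) = 0.
  move=> u; have perm4' a' b' c' e' :
      perm_eq [:: a; b; c; e] [:: a'; b'; c'; e'] -> uniq [:: a'; b'; c'; e'].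
    by move/perm_uniq <-.
  apply/eqP; apply: contra_notT nS; apply: (star_case degD u).
  - by apply: (T a b e c); apply: perm4'; apply/permP => q /=; lia.
  - by apply: (T a c e b); apply: perm4'; apply/permP => q /=; lia.
  - by apply: (T b c e a); apply: perm4'; apply/permP => q /=; lia.
  - exact: (T _ _ _ _ u).
split; [exact: (T _ _ _ _ uijkl) | exact: S | apply: path_case => //].
- exact: (T _ _ _ _ uijkl).
- by apply: (S i j l k); apply: perm4; apply/permP => q /=; lia.
- by apply: (T j l k i); apply: perm4; apply/permP => q /=; lia.
- by apply: (S i k l j); apply: perm4; apply/permP => q /=; lia.
Qed.

End Forms.

(** * Relabelling vertices, and the triples of edges of [K_4] *)

Section Edges.
Variable K : numFieldType.
Implicit Types (l : 'rV[K]_6) (D : 'I_4 -> 'I_4 -> 'rV[K]_3).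

Lemma lcC l i j : lc l i j = lc l j i.
Proof. by rewrite /lc /edge_idx minnC maxnC. Qed.

Lemma val_vertices : [/\ v1 = 0 :> nat, v2 = 1 :> nat, v3 = 2 :> nat & v4 = 3 :> nat]%N.
Proof. by split; rewrite /= inordK. Qed.

Lemma uniq_vertices : uniq [:: v1; v2; v3; v4].
Proof. by rewrite /= !inE -!val_eqE /=; have [-> -> -> ->] := val_vertices. Qed.

Lemma det_L24 l : \det (L24_matrix l) =
  cayley (lc l v1 v2) (lc l v1 v3) (lc l v1 v4) (lc l v2 v3) (lc l v2 v4) (lc l v3 v4).
Proof.
have [e1 e2 e3 e4] := val_vertices.
have w1 : widen_ord (leqnSn 3) o0 = v1 by apply: val_inj; rewrite /= e1.
have w2 : widen_ord (leqnSn 3) o1 = v2 by apply: val_inj; rewrite /= e2.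
have w3 : widen_ord (leqnSn 3) o2 = v3 by apply: val_inj; rewrite /= e3.
have w4 : ord_max = v4 by apply: val_inj; rewrite /= e4.
rewrite det_mx33 !mxE /= w1 w2 w3 w4 (lcC l v2 v1) (lcC l v3 v1) (lcC l v3 v2) /cayley.
by ring.
Qed.

(** [cayley] is a multiple of the squared volume, so the labelling is irrelevant; the 24 labellings
    are checked one by one. *)
Lemma cayley_perm (d : 'I_4 -> 'I_4 -> K) (i j k l : 'I_4) : (forall m n, d m n = d n m) ->
  uniq [:: i; j; k; l] ->
  cayley (d i j) (d i k) (d i l) (d j k) (d j l) (d k l) =
  cayley (d v1 v2) (d v1 v3) (d v1 v4) (d v2 v3) (d v2 v4) (d v3 v4).
Proof.
move=> dC u.
have [ei|ei|ei|ei] := uniq4_cases uniq_vertices i;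
have [ej|ej|ej|ej] := uniq4_cases uniq_vertices j;
rewrite {}ei {}ej in u *;
(try by move: u; rewrite /= !inE eqxx ?orbT);
have [ek|ek|ek|ek] := uniq4_cases uniq_vertices k;
rewrite {}ek in u *;
(try by move: u; rewrite /= !inE eqxx ?orbT ?andbF);
have [el|el|el|el] := uniq4_cases uniq_vertices l;
rewrite {}el in u *;
(try by move: u; rewrite /= !inE eqxx ?orbT ?andbF);
rewrite ?(dC v2 v1) ?(dC v3 v1) ?(dC v4 v1) ?(dC v3 v2) ?(dC v4 v2) ?(dC v4 v3);
by rewrite /cayley; ring.
Qed.

Definition edge_forms D : seq 'rV[K]_3 :=
  [:: D v1 v2; D v1 v3; D v1 v4; D v2 v3; D v2 v4; D v3 v4].

Ltac distinct_vertices :=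
  rewrite /= !inE -!val_eqE /=; have [-> -> -> ->] := val_vertices.

Lemma nonsingular_edge_forms D p q r : degenerate D -> ~ singular D ->
  (p < 6)%N -> (q < 6)%N -> (r < 6)%N ->
  let E := edge_forms D in \det (frame E`_p E`_q E`_r) = 0.
Proof.
move=> degD nS pE qE rE E; apply: (@det_frame_sorted _ E) pE qE rE; rewrite {}/E.
have DC := degD.1; have ND a b c e := @nonsingular_dependent _ D a b c e degD nS.
pose DE := (DC v2 v1, DC v3 v1, DC v4 v1, DC v3 v2, DC v4 v2, DC v4 v3).
move=> p' q' r' /andP[pq qr] r6.
have q6 := ltn_trans qr r6; have p6 := ltn_trans pq q6; move: p6 q6 r6 pq qr.
case: p' => [|[|[|[|[|[|p']]]]]] // _; case: q' => [|[|[|[|[|[|q']]]]]] // _;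
  case: r' => [|[|[|[|[|[|r']]]]]] // _ _ _ /=.
(* The 20 increasing triples of edges are 4 stars, 4 triangles and 12 paths; the order of the
   vertices selects the triple. *)
- have [|_ H _] := ND v2 v3 v4 v1; first by distinct_vertices.
  by rewrite ?DE in H; exact: H.
- have [|H _ _] := ND v2 v3 v1 v4; first by distinct_vertices.
  by rewrite ?DE in H; exact: H.
- have [|_ _ H] := ND v3 v1 v2 v4; first by distinct_vertices.
  by rewrite ?DE in H; exact: (det_frameC12 H).
- have [|_ _ H] := ND v2 v1 v3 v4; first by distinct_vertices.
  by rewrite ?DE in H; exact: H.
- have [|_ _ H] := ND v4 v1 v2 v3; first by distinct_vertices.
  by rewrite ?DE in H; exact: (det_frameC12 H).
- have [|H _ _] := ND v2 v4 v1 v3; first by distinct_vertices.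
  by rewrite ?DE in H; exact: H.
- have [|_ _ H] := ND v2 v1 v4 v3; first by distinct_vertices.
  by rewrite ?DE in H; exact: H.
- have [|_ H _] := ND v1 v3 v4 v2; first by distinct_vertices.
  by rewrite ?DE in H; exact: H.
- have [|_ _ H] := ND v1 v2 v3 v4; first by distinct_vertices.
  by rewrite ?DE in H; exact: H.
- have [|_ _ H] := ND v1 v2 v4 v3; first by distinct_vertices.
  by rewrite ?DE in H; exact: H.
- have [|_ _ H] := ND v4 v1 v3 v2; first by distinct_vertices.
  by rewrite ?DE in H; exact: (det_frameC12 H).
- have [|_ _ H] := ND v3 v1 v4 v2; first by distinct_vertices.
  by rewrite ?DE in H; exact: H.
- have [|H _ _] := ND v3 v4 v1 v2; first by distinct_vertices.
  by rewrite ?DE in H; exact: H.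
- have [|_ _ H] := ND v1 v3 v2 v4; first by distinct_vertices.
  by rewrite ?DE in H; exact: H.
- have [|_ H _] := ND v1 v2 v4 v3; first by distinct_vertices.
  by rewrite ?DE in H; exact: H.
- have [|_ _ H] := ND v1 v3 v4 v2; first by distinct_vertices.
  by rewrite ?DE in H; exact: (det_frameC23 H).
- have [|_ _ H] := ND v1 v4 v2 v3; first by distinct_vertices.
  by rewrite ?DE in H; exact: (det_frameC23 H).
- have [|_ _ H] := ND v1 v4 v3 v2; first by distinct_vertices.
  by rewrite ?DE in H; exact: (det_frameC23 H).
- have [|_ H _] := ND v1 v2 v3 v4; first by distinct_vertices.
  by rewrite ?DE in H; exact: H.
- have [|H _ _] := ND v3 v4 v2 v1; first by distinct_vertices.
  by rewrite ?DE in H; exact: H.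
Qed.

End Edges.

(** * From linear forms back to subspaces *)

Section Subspaces.
Variable K : numFieldType.
Implicit Types (l : 'rV[K]_6) (U : {vspace 'rV[K]_6}).

Lemma edge_surj (k : 'I_6) : exists i j : 'I_4, i != j /\ inord (edge_idx i j) = k.
Proof.
have E (i j : nat) : (i < 4)%N -> (j < 4)%N -> i != j -> edge_idx i j = k ->
    exists i j : 'I_4, i != j /\ inord (edge_idx i j) = k.
  move=> i4 j4 ij kE; exists (Ordinal i4), (Ordinal j4).
  by split=> //; rewrite kE inord_val.
case: k E => -[|[|[|[|[|[|//]]]]]] ? E.
- exact: (E 0%N 1%N).
- exact: (E 0%N 2%N).
- exact: (E 0%N 3%N).
- exact: (E 1%N 2%N).
- exact: (E 1%N 3%N).
- exact: (E 2%N 3%N).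
Qed.

Lemma lc_eq0 l (a b c e : 'I_4) : uniq [:: a; b; c; e] ->
  lc l a b = 0 -> lc l a c = 0 -> lc l a e = 0 ->
  lc l b c = 0 -> lc l b e = 0 -> lc l c e = 0 -> l = 0.
Proof.
move=> u ab ac ae bc be ce; apply/rowP => k; rewrite mxE.
have [i [j [ij <-]]] := edge_surj k; rewrite -/(lc l i j).
by have [Ei|Ei|Ei|Ei] := uniq4_cases u i; have [Ej|Ej|Ej|Ej] := uniq4_cases u j;
  move: ij; rewrite Ei Ej ?eqxx // lcC.
Qed.

(** The three coordinates are injective on [U], hence map it onto the three-dimensional space. A
    point of [S] then shares them with a point of [U], and the difference of the two is zero. *)
Lemma mem_of_coordinates U (S : pred 'rV[K]_6) (i1 i2 i3 : 'I_6) :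
  \dim U = 3%N -> {subset U <= S} ->
  (forall l u, S l -> S u -> S (l - u)) ->
  (forall l, S l -> l 0 i1 = 0 -> l 0 i2 = 0 -> l 0 i3 = 0 -> l = 0) ->
  forall l, (l \in U) = S l.
Proof.
move=> dU US SB S0 l; apply/idP/idP => [/US //|Sl].
pose s (k : 'I_3) := nth i1 [:: i1; i2; i3] k.
pose f : 'Hom('rV[K]_6, 'rV[K]_3) := linfun (mulmxr (mxsub id s 1%:M)).
have fE v k : f v 0 k = v 0 (s k) by rewrite lfunE /= mulmx_colsub mulmx1 mxE.
have f0 v : S v -> f v = 0 -> v = 0.
  move=> Sv /rowP fv; apply: S0 => //.
  - by have := fv o0; rewrite fE mxE.
  - by have := fv o1; rewrite fE mxE.
  - by have := fv o2; rewrite fE mxE.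
have ker0 : (U :&: lker f = 0)%VS.
  apply/eqP; rewrite -subv0; apply/subvP => v; rewrite memv_cap memv_ker memv0.
  by case/andP=> /US Sv /eqP /(f0 _ Sv) ->.
have : (f @: U == fullv)%VS.
  by rewrite eqEdim subvf dimvf (limg_dim_eq ker0) dU.
move/eqP/vspaceP/(_ (f l)); rewrite memvf => /memv_imgP[u uU flu].
suff -> : l = u by [].
apply/eqP; rewrite -subr_eq0; apply/eqP; apply: f0; first by apply: SB => //; apply: US.
by rewrite linearB /= flu subrr.
Qed.

(** The row attached to [i], [j] is the restriction of the coordinate to [U], written in the basis
    [X]. Were it not singular, any three of the six forms would be dependent, against the rank 3 of
    the basis. *)
Lemma singular_forms U (X : 3.-tuple 'rV[K]_6) : basis_of U X ->
  {subset U <= [pred l | in_L24 l]} -> singular (fun i j => \row_k lc X`_k i j).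
Proof.
move=> Xb UL; apply: boolp.contrapT => nS; set D := fun i j => _ in nS.
have lcE (t : 'cV[K]_3) i j : lc (\sum_(k < 3) t k 0 *: X`_k) i j = value (D i j) t.
  by rewrite /lc summxE /value mxE; apply: eq_bigr => k _; rewrite !mxE mulrC.
have degD : degenerate D.
  split=> [i j|i j k l u t]; first by apply/rowP => k; rewrite !mxE lcC.
  rewrite -!lcE cayley_perm //; last by move=> *; exact: lcC.
  rewrite -det_L24; apply/eqP/UL/memv_suml => m _; apply: memvZ.
  by apply: (basis_mem Xb); rewrite mem_nth // size_tuple.
pose B : 'M[K]_(3, 6) := \matrix_k X`_k.
have rfB : row_free B.
  apply: inj_row_free => v vB0; apply/rowP => k; rewrite mxE.
  have /freeP := basis_free Xb; apply.
  by rewrite -[RHS]vB0 mulmx_sum_row; apply: eq_bigr => m _; rewrite rowK.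
have fullBT : row_full B^T by rewrite /row_full mxrank_tr.
(* Full rank provides three edges whose forms make an invertible matrix. *)
have := fullrowsub_full fullBT; rewrite row_full_unit unitmxE unitfE; apply/negP/negPn/eqP.
have rE k : row k B^T = (edge_forms D)`_k.
  have [e1 e2 e3 e4] := val_vertices.
  have DE i j : D i j = row (inord (edge_idx i j)) B^T.
    by apply/rowP => m; rewrite !mxE.
  rewrite /edge_forms !DE /edge_idx e1 e2 e3 e4 /=.
  by case: k => -[|[|[|[|[|[|//]]]]]] ?; congr row; apply: val_inj; rewrite /= inordK.
set g := fullrankfun _.
rewrite (_ : rowsub g B^T =
  frame (edge_forms D)`_(g o0) (edge_forms D)`_(g o1) (edge_forms D)`_(g o2)).
  by apply: nonsingular_edge_forms.
by apply/row_matrixP; apply: ord3P; rewrite row_rowsub rowK rE.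
Qed.

Lemma lcB l u i j : lc (l - u) i j = lc l i j - lc u i j.
Proof. by rewrite /lc !mxE. Qed.

Lemma sgn_neq0 (s : bool) : sgn K s != 0.
Proof. by case: s; rewrite /sgn ?oppr_eq0 oner_eq0. Qed.

Lemma fourth_vertex (a b c : 'I_4) :
  uniq [:: a; b; c] -> exists e, uniq [:: a; b; c; e].
Proof.
move=> u; have [e ne] : exists e, e \notin [:: a; b; c].
  apply/existsP; apply: contraT => /existsPn H.
  have : (size (enum 'I_4) <= size [:: a; b; c])%N.
    by apply: uniq_leq_size (enum_uniq _) _ => e _; have := H e; rewrite negbK.
  by rewrite size_enum_ord.
by exists e; rewrite -[[:: a; b; c; e]]/(rcons [:: a; b; c] e) rcons_uniq ne.
Qed.

Lemma in_basis_lc U (X : 3.-tuple 'rV[K]_6) l : basis_of U X -> l \in U ->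
  exists t, forall i j, lc l i j = value (\row_k lc X`_k i j) t.
Proof.
move=> Xb lU; exists (\col_k coord X k l) => i j.
rewrite {1}(coord_basis Xb lU) /lc summxE /value mxE.
by apply: eq_bigr => k _; rewrite !mxE mulrC.
Qed.

Lemma valueB (f g : 'rV[K]_3) t : value (f - g) t = value f t - value g t.
Proof. by rewrite /value mulmxBl !mxE. Qed.

Lemma valueZ (c : K) (f : 'rV[K]_3) t : value (c *: f) t = c * value f t.
Proof. by rewrite /value -scalemxAl mxE. Qed.

Lemma value0 t : value (0 : 'rV[K]_3) t = 0.
Proof. by rewrite /value mul0mx mxE. Qed.

Lemma sgn_exists (f g : 'rV[K]_3) : f = g \/ f = - g -> exists s, f = sgn K s *: g.
Proof.
by case=> ->; [exists true | exists false]; rewrite /sgn ?scale1r ?scaleN1r.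
Qed.

Lemma dim3_component U : {subset U <= [pred l | in_L24 l]} ->
  \dim U = 3%N -> is_sing_component U.
Proof.
move=> UL dU.
have [X Xb] : exists X : 3.-tuple 'rV[K]_6, basis_of U X.
  have : exists X : (\dim U).-tuple 'rV[K]_6, basis_of U X by exists (vbasis U); apply: vbasisP.
  by rewrite dU.
have sub0 (x y : K) : x = 0 -> y = 0 -> x - y = 0 by move=> -> ->; rewrite subrr.
case: (singular_forms Xb UL).
- case=> p Hp; left.
  have uv := uniq_vertices.
  move: uv; rewrite /= !inE !negb_or => /and4P[/and3P[n12 n13 n14] /andP[n23 n24] n34 _].
  have [s12 D12] := sgn_exists (Hp _ _ n12); have [s13 D13] := sgn_exists (Hp _ _ n13).
  have [s14 D14] := sgn_exists (Hp _ _ n14); have [s23 D23] := sgn_exists (Hp _ _ n23).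
  have [s24 D24] := sgn_exists (Hp _ _ n24); have [s34 D34] := sgn_exists (Hp _ _ n34).
  (* The signs are multiplied by [s12], since [singA] gives the edge 12 the coefficient 1. *)
  exists (s12 == s13), (s12 == s14), (s12 == s23), (s12 == s24), (s12 == s34).
  apply: (mem_of_coordinates (i1 := inord (edge_idx v1 v2))
    (i2 := inord (edge_idx v1 v3)) (i3 := inord (edge_idx v1 v4))) => //.
  + move=> l /(in_basis_lc Xb)[t lE].
    rewrite -topredE /= /singA !lE D12 D13 D14 D23 D24 D34 !valueZ !valueB.
    apply/and3P; split; apply/eqP; rewrite /sgn.
    * by case: (s12) (s13) (s23) => [] [] []; rewrite /=; ring.
    * by case: (s12) (s14) (s24) => [] [] []; rewrite /=; ring.
    * by case: (s12) (s13) (s14) (s34) => [] [] [] []; rewrite /=; ring.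
  + move=> l u /and3P[/eqP l1 /eqP l2 /eqP l3] /and3P[/eqP u1 /eqP u2 /eqP u3].
    apply/and3P; rewrite !lcB; split; apply/eqP.
    * by rewrite -[RHS](sub0 _ _ l1 u1); ring.
    * by rewrite -[RHS](sub0 _ _ l2 u2); ring.
    * by rewrite -[RHS](sub0 _ _ l3 u3); ring.
  + move=> l; rewrite -/(lc l v1 v2) -/(lc l v1 v3) -/(lc l v1 v4).
    move=> /and3P[+ + +] l12 l13 l14; rewrite l12 l13 l14.
    rewrite !mulr0 !subr0 !add0r !mulf_eq0 !(negbTE (sgn_neq0 _)) /=.
    by move=> /eqP ? /eqP ? /eqP ?; apply: (lc_eq0 uniq_vertices).
- case=> a [b [c [e [u [Dab /sgn_exists[t1 Dac] /sgn_exists[t2 Dae]]]]]].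
  right; left; exists a, b, c, e; split=> //; exists t1, t2.
  apply: (mem_of_coordinates (i1 := inord (edge_idx b c))
    (i2 := inord (edge_idx b e)) (i3 := inord (edge_idx c e))) => //.
  + move=> l /(in_basis_lc Xb)[t lE].
    by rewrite -topredE /= /singB !lE Dab Dac Dae !valueZ value0 !eqxx.
  + move=> l u' /and3P[/eqP l1 /eqP l2 /eqP l3] /and3P[/eqP u1 /eqP u2 /eqP u3].
    by rewrite /singB !lcB l1 l2 l3 u1 u2 u3 subrr -!mulrBr !eqxx.
  + move=> l; rewrite -/(lc l b c) -/(lc l b e) -/(lc l c e).
    move=> /and3P[/eqP ab /eqP ac /eqP ae] bc be ce.
    by apply: (lc_eq0 u); rewrite ?ac ?ae ?bc ?be ?mulr0.
- case=> a [b [c [u [Dab Dac Dbc]]]]; right; right; exists a, b, c; split=> //.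
  have [e ue] := fourth_vertex u.
  apply: (mem_of_coordinates (i1 := inord (edge_idx a e))
    (i2 := inord (edge_idx b e)) (i3 := inord (edge_idx c e))) => //.
  + move=> l /(in_basis_lc Xb)[t lE].
    by rewrite -topredE /= /singC !lE Dab Dac Dbc value0 eqxx.
  + move=> l u' /and3P[/eqP l1 /eqP l2 /eqP l3] /and3P[/eqP u1 /eqP u2 /eqP u3].
    by rewrite /singC !lcB l1 l2 l3 u1 u2 u3 subrr eqxx.
  + move=> l; rewrite -/(lc l a e) -/(lc l b e) -/(lc l c e).
    by move=> /and3P[/eqP ab /eqP ac /eqP bc] ae be ce; apply: (lc_eq0 ue).
Qed.

Lemma edge_idx_lt (i j : 'I_4) : (edge_idx i j < 6)%N.
Proof. by rewrite /edge_idx; case: (minn i j) => [|[|m]]; case: (maxn i j) => [|[|[|[|n]]]]. Qed.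

Lemma edge_idx_inj (i j c e : 'I_4) : i != j -> c != e ->
  edge_idx i j = edge_idx c e -> (i == c) && (j == e) || (i == e) && (j == c).
Proof.
rewrite -!val_eqE /=.
by case: i j c e => [[|[|[|[|?]]]] ?] // [[|[|[|[|?]]]] ?] // [[|[|[|[|?]]]] ?] //
  [[|[|[|[|?]]]] ?].
Qed.

Lemma lc_delta (i j c e : 'I_4) : i != j -> c != e ->
  ~~ ((i == c) && (j == e) || (i == e) && (j == c)) ->
  lc (delta_mx 0 (inord (edge_idx c e)) : 'rV[K]_6) i j = 0.
Proof.
move=> ij ce H; rewrite /lc mxE eqxx /=; case: eqP => // /(congr1 val).
rewrite /= !inordK ?edge_idx_lt // => /(edge_idx_inj ij ce); by rewrite (negbTE H).
Qed.

(** No component lies in the hyperplane of coordinate sum zero, which is what [dim_le3]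
    contradicts. *)
Lemma component_sum_neq0 U : is_sing_component U ->
  exists2 l, l \in U & \sum_k l 0 k != 0.
Proof.
have sum_delta k : \sum_m (delta_mx 0 k : 'rV[K]_6) 0 m != 0.
  rewrite (bigD1 k) //= big1 => [|m /negbTE mk]; rewrite mxE ?mk // !eqxx addr0.
  by rewrite oner_eq0.
case=> [[s13 [s14 [s23 [s24 [s34 UE]]]]]|[]].
- have [e1 e2 e3 e4] := val_vertices.
  (* Vertices 1, 2, 3 coincide at distance one from vertex 4; the sum of three signs is odd, hence
     nonzero. *)
  exists (\row_k nth 0 [:: 0; 0; sgn K s14; 0; sgn K s24; sgn K s34] k).
    rewrite UE /singA /lc /edge_idx e1 e2 e3 e4 /=.
    rewrite !mxE !inordK //= !mulr0 !subr0 !addr0 eqxx !sub0r !sgn_sqr.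
    by rewrite !(addrC _ 1) !subrr eqxx.
  rewrite !big_ord_recl big_ord0 !mxE /= !add0r addr0.
  case: (s14) (s24) (s34) => [] [] []; rewrite /sgn.
  + by rewrite (_ : _ + _ = 3) ?pnatr_eq0 //; ring.
  + by rewrite (_ : _ + _ = 1) ?oner_eq0 //; ring.
  + by rewrite (_ : _ + _ = 1) ?oner_eq0 //; ring.
  + by rewrite (_ : _ + _ = -1) ?oppr_eq0 ?oner_eq0 //; ring.
  + by rewrite (_ : _ + _ = 1) ?oner_eq0 //; ring.
  + by rewrite (_ : _ + _ = -1) ?oppr_eq0 ?oner_eq0 //; ring.
  + by rewrite (_ : _ + _ = -1) ?oppr_eq0 ?oner_eq0 //; ring.
  + by rewrite (_ : _ + _ = -3) ?oppr_eq0 ?pnatr_eq0 //; ring.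
- case=> a [b [c [e [u [t1 [t2 UE]]]]]].
  (* The edge [c], [e] occurs in none of the three equations. *)
  exists (delta_mx 0 (inord (edge_idx c e))) => //.
  move: u; rewrite /= !inE !negb_or => /and4P[/and3P[ab ac ae] /andP[bc be] ce _].
  rewrite UE /singB !lc_delta // ?mulr0 ?eqxx //;
    by rewrite ?(negbTE ab) ?(negbTE ac) ?(negbTE ae) ?(negbTE bc) ?(negbTE be) ?andbF.
- case=> a [b [c [u UE]]]; have [e ue] := fourth_vertex u.
  exists (delta_mx 0 (inord (edge_idx a e))) => //.
  move: ue; rewrite /= !inE !negb_or => /and4P[/and3P[ab ac ae] /andP[bc be] ce _].
  rewrite UE /singC !lc_delta // ?eqxx //;
    by rewrite ?(eq_sym b a) ?(eq_sym c a)
               ?(negbTE ab) ?(negbTE ac) ?(negbTE be) ?(negbTE ce) ?andbF.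
Qed.

Lemma subspace_dim3 U : (3 <= \dim U)%N -> exists2 W, (W <= U)%VS & \dim W = 3%N.
Proof.
move=> d3; exists <<take 3 (vbasis U)>>%VS.
  apply/span_subvP => v /mem_take; exact: vbasis_mem.
have fr : free (take 3 (vbasis U)).
  by have := basis_free (vbasisP U); rewrite -{1}(cat_take_drop 3 (vbasis U)) => /catl_free.
by move: fr; rewrite /free => /eqP ->; rewrite size_takel // size_tuple.
Qed.

Lemma dim_le3 U : {subset U <= [pred l | in_L24 l]} -> (\dim U <= 3)%N.
Proof.
move=> UL; rewrite leqNgt; apply/negP => d4.
(* [g] is the sum of the six coordinates. *)
pose g : 'Hom('rV[K]_6, 'rV[K]_1) := linfun (mulmxr (const_mx 1)).
have : (3 <= \dim (U :&: lker g)%VS)%N.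
  have g1 : (\dim (g @: U) <= 1)%N by rewrite (leq_trans (dimvS (subvf _))) // dimvf.
  by rewrite -(leq_add2r (\dim (g @: U))) limg_ker_dim; apply: leq_trans d4; rewrite leq_add2l.
case/subspace_dim3 => W WU dW.
have [|l /(subvP WU)] := component_sum_neq0 (dim3_component _ dW).
  by move=> l /(subvP WU); rewrite memv_cap => /andP[/UL].
rewrite memv_cap memv_ker => /andP[_ /eqP/rowP/(_ 0)]; rewrite lfunE /= !mxE.
by rewrite (eq_bigr (fun k => l 0 k)) => [->|k _]; rewrite ?eqxx // mxE mulr1.
Qed.

End Subspaces.

(* C^6 with C = complex R for R : realType (i.e. the complex numbers). *)
Theorem theoremB2 (R : realType) (U : {vspace 'rV[complex R]_6}) :
  {subset U <= [pred l | in_L24 l]} ->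
  (\dim U <= 3)%N /\ ((\dim U = 3)%N -> is_sing_component U).
Proof. by move=> UL; split; [exact: dim_le3 | exact: dim3_component]. Qed.
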